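(* Let $\mathcal{K}$ be a finite hypergroup of order four. Then $\mathcal{K}$ is commutative.
   Context: For a finite set $K=\{c_0,c_1,\dots,c_n\}$ (distinct elements), let $M^b(K)=\{\sum_{j=0}^n a_j\delta_{c_j}: a_j\in\mathbb{C}\}$ be the complex measures on $K$ and $M^1(K)=\{\sum_j a_j\delta_{c_j}: a_j\ge 0,\ \sum_j a_j=1\}$ the probability measures, where $\delta_c$ is the Dirac measure at $c$. The support of $\mu=\sum_j a_j\delta_{c_j}$ is $\mathrm{supp}(\mu)=\{c_j: a_j\neq 0\}$. A finite hypergroup $\mathcal{K}=(K,M^b(K),\circ,* )$ is a finite set $K=\{c_0,\dots,c_n\}$ together with a product $\circ$ (convolution) and an involution $*$ on $M^b(K)$ such that: (a) $(M^b(K),\circ,* )$ is an associative $*$-algebra with unit $\delta_{c_0}$; (b) $\delta_{c_i}\circ\delta_{c_j}\in M^1(K)$ for all $c_i,c_j\in K$; (c) there is an involutive bijection $c_i\mapsto c_i^*$ of $K$ with $\delta_{c_i^*}=\delta_{c_i}^*$, and for all $c_i,c_j\in K$ one has $c_j=c_i^*$ if and only if $c_0\in\mathrm{supp}(\delta_{c_i}\circ\delta_{c_j})$. The order of $\mathcal{K}$ is the number of elements of $K$. $\mathcal{K}$ is commutative if $\circ$ is commutative on $M^b(K)$. *)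

(* Defs.v *)
From HB Require Import structures.
From mathcomp Require Import all_boot all_order all_algebra.
From mathcomp Require Import complex.
From mathcomp Require Import reals.

Set Implicit Arguments.
Unset Strict Implicit.
Unset Printing Implicit Defensive.

Import Order.TTheory GRing.Theory Num.Theory.

Local Open Scope ring_scope.
Local Open Scope complex_scope.

(* Complex measures on the finite set K: [mu c] is the coefficient of the
   Dirac measure at c.  The annotation [^o] makes the coefficients a module
   over themselves, so that the library's vector space structure on finite
   functions applies. *)
Notation measures R K := {ffun K -> (R[i])^o}.

Definition dirac (R : realType) (K : finType) (c : K) : measures R K :=
  [ffun x => (x == c)%:R].

(* In R[i], [0 <= z] means that z is real and nonnegative. *)
Definition is_probability (R : realType) (K : finType) (mu : measures R K) :
  Prop :=
  (forall c, 0 <= (mu c : R[i])) /\ \sum_(c : K) (mu c : R[i]) = 1.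

Definition supp (R : realType) (K : finType) (mu : measures R K) : {set K} :=
  [set c | mu c != 0].

Record is_star_algebra (R : realType) (V : lmodType R[i])
    (mul : V -> V -> V) (one : V) (star : V -> V) : Prop := IsStarAlgebra {
  mul_linear_r : forall x, linear (mul x);
  mul_linear_l : forall y, linear (mul^~ y);
  mul_assoc : associative mul;
  mul_left_id : left_id one mul;
  mul_right_id : right_id one mul;
  star_conj_linear : forall (a : R[i]) (x y : V),
    star (a *: x + y) = Num.conj a *: star x + star y;
  star_involutive : involutive star;
  star_antimult : forall x y, star (mul x y) = mul (star y) (star x)
}.

Record hypergroup (R : realType) (K : finType) := Hypergroup {
  hunit : K;
  conv : measures R K -> measures R K -> measures R K;
  hstar : measures R K -> measures R K;
  hypergroup_star_algebra : is_star_algebra conv (dirac R hunit) hstar;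
  hypergroup_probability : forall ci cj : K,
    is_probability (conv (dirac R ci) (dirac R cj));
  hypergroup_inverse : exists inv : K -> K,
    [/\ involutive inv,
        forall c : K, dirac R (inv c) = hstar (dirac R c)
      & forall ci cj : K,
          cj = inv ci <-> hunit \in supp (conv (dirac R ci) (dirac R cj))]
}.

Definition order_hypergroup (R : realType) (K : finType)
  (H : hypergroup R K) : nat := #|K|.

Definition commutative_hypergroup (R : realType) (K : finType)
  (H : hypergroup R K) : Prop := commutative (conv H).

(* Main.v *)
(** Write [n i j k] for the coefficient of [c_k] in [c_i o c_j], [e] for the
    unit and [t i = n i i* e > 0].  Associativity, read at the coefficient of
    [e], is the Frobenius reciprocity [n i j k * t k = n j k* i* * t i], and
    the antimultiplicativity of [*] gives [n j* i* k* = n i j k].  If every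
    element is self-adjoint, the latter is already commutativity.  Otherwise
    the elements are [e, a, b = a*, c = c*].  Reciprocity gives
    [n a a k * (t a - t b) = 0] for all [k], so [t a = t b] since [c_a o c_a]
    has mass one; the remaining reciprocity relations then yield
    commutativity. *)
From HB Require Import structures.
Require Import Defs.
From mathcomp Require Import all_boot all_order all_algebra.
From mathcomp Require Import complex.
From mathcomp Require Import reals.
From mathcomp Require Import ring.

Set Implicit Arguments.
Unset Strict Implicit.
Unset Printing Implicit Defensive.

Import Order.TTheory GRing.Theory Num.Theory.

Local Open Scope ring_scope.
Local Open Scope complex_scope.

Definition structure_const (R : realType) (K : finType) (H : hypergroup R K)
  (i j k : K) : R[i] := conv H (dirac R i) (dirac R j) k.

Lemma measure_dirac_sum (R : realType) (K : finType) (mu : measures R K) :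
  mu = \sum_(c : K) mu c *: dirac R c.
Proof.
apply/ffunP => x; rewrite sum_ffunE (bigD1 x) //= big1 ?addr0 => [|c cx].
  by rewrite !ffunE eqxx /GRing.scale /= mulr1.
by rewrite !ffunE eq_sym (negbTE cx) /GRing.scale /= mulr0.
Qed.

Lemma conv_sumr (R : realType) (K : finType) (H : hypergroup R K)
    (mu nu : measures R K) :
  conv H mu nu = \sum_(c : K) nu c *: conv H mu (dirac R c).
Proof.
pose F : {linear measures R K -> measures R K} := HB.pack (conv H mu)
  (GRing.isLinear.Build _ _ _ _ _ (mul_linear_r (hypergroup_star_algebra H) mu)).
rewrite {1}[nu]measure_dirac_sum -[conv H mu]/(F : _ -> _) linear_sum.
by apply: eq_bigr => c _; rewrite linearZ.
Qed.

Lemma conv_suml (R : realType) (K : finType) (H : hypergroup R K)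
    (mu nu : measures R K) :
  conv H mu nu = \sum_(c : K) mu c *: conv H (dirac R c) nu.
Proof.
pose F : {linear measures R K -> measures R K} := HB.pack ((conv H)^~ nu)
  (GRing.isLinear.Build _ _ _ _ _ (mul_linear_l (hypergroup_star_algebra H) nu)).
rewrite {1}[mu]measure_dirac_sum -[conv H _ nu]/(F _) linear_sum.
by apply: eq_bigr => c _; rewrite linearZ.
Qed.

Lemma hstar_sum (R : realType) (K : finType) (H : hypergroup R K)
    (mu : measures R K) :
  hstar H mu = \sum_(c : K) Num.conj (mu c : R[i]) *: hstar H (dirac R c).
Proof.
have HA := hypergroup_star_algebra H.
(* The base case of the induction over the sum; conjugate-linearity at [0 + 0] forces it. *)
have star0 : hstar H 0 = 0.
  have := star_conj_linear HA 1 0 0.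
  rewrite scaler0 addr0 rmorph1 scale1r => /eqP.
  by rewrite addrC -subr_eq subrr => /eqP.
rewrite {1}[mu]measure_dirac_sum.
elim/big_rec2: _ => // c y x _ <-.
exact: (star_conj_linear HA).
Qed.

(** Bilinearity reduces commutativity to pairs of Dirac measures. *)
Lemma commutative_structure_const (R : realType) (K : finType)
    (H : hypergroup R K) :
  (forall i j k, structure_const H i j k = structure_const H j i k) ->
  commutative_hypergroup H.
Proof.
move=> comm mu nu; rewrite conv_sumr [RHS]conv_suml.
apply: eq_bigr => j _; congr (_ *: _).
rewrite conv_suml [RHS]conv_sumr; apply: eq_bigr => i _; congr (_ *: _).
by apply/ffunP => k; apply: comm.
Qed.

Lemma structure_const_assoc (R : realType) (K : finType) (H : hypergroup R K)
    (i j k m : K) :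
  \sum_(l : K) structure_const H i j l * structure_const H l k m =
  \sum_(l : K) structure_const H j k l * structure_const H i l m.
Proof.
have := mul_assoc (hypergroup_star_algebra H)
  (dirac R i) (dirac R j) (dirac R k).
rewrite conv_sumr [RHS]conv_suml => /ffunP/(_ m).
rewrite !sum_ffunE => E; symmetry.
transitivity (\sum_(l : K) (conv H (dirac R j) (dirac R k) l *:
                            conv H (dirac R i) (dirac R l)) m).
  by apply: eq_bigr => l _; rewrite ffunE.
by rewrite E; apply: eq_bigr => l _; rewrite ffunE.
Qed.

(** Antimultiplicativity on Dirac measures; the conjugation that [hstar] puts on the coefficients
    disappears because they are nonnegative, hence real. *)
Lemma structure_const_star (R : realType) (K : finType) (H : hypergroup R K)
    (inv : K -> K) (invK : involutive inv)
    (inv_star : forall c, dirac R (inv c) = hstar H (dirac R c)) (i j k : K) :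
  structure_const H (inv j) (inv i) (inv k) = structure_const H i j k.
Proof.
rewrite /structure_const !inv_star.
rewrite -(star_antimult (hypergroup_star_algebra H)) hstar_sum sum_ffunE.
rewrite (bigD1 k) //= big1 ?addr0 => [|l lk].
  rewrite -inv_star !ffunE eqxx /GRing.scale /= mulr1.
  apply: conj_Creal; apply: ger0_real.
  by case: (hypergroup_probability H i j).
rewrite -inv_star !ffunE (inj_eq (inv_inj invK)) eq_sym (negbTE lk).
by rewrite /GRing.scale /= mulr0.
Qed.

(** The two bracketings of the product of [i], [j], [inv k] are compared at the unit. By the support
    axiom each sum keeps a single term: [l = k] in one, [l = inv i] in the other. *)
Lemma structure_const_frobenius (R : realType) (K : finType)
    (H : hypergroup R K) (inv : K -> K) (invK : involutive inv)
    (inv_supp : forall i j, j = inv i <->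
       hunit H \in supp (conv H (dirac R i) (dirac R j))) (i j k : K) :
  structure_const H i j k * structure_const H k (inv k) (hunit H) =
  structure_const H j (inv k) (inv i) * structure_const H i (inv i) (hunit H).
Proof.
have n0 l m : m != inv l -> structure_const H l m (hunit H) = 0.
  move=> ml; apply/eqP; apply: contraNT ml => nz.
  by apply/eqP/inv_supp; rewrite inE.
have := structure_const_assoc H i j (inv k) (hunit H).
rewrite (bigD1 k) //= big1 ?addr0 => [->|l lk]; last first.
  by rewrite n0 ?mulr0 // (inj_eq (inv_inj invK)) eq_sym.
by rewrite (bigD1 (inv i)) //= big1 ?addr0 // => l li; rewrite n0 ?mulr0.
Qed.

(** The algebraic core, for an involution swapping [a] and [b]. Positivity enters only through
    [t_nz], which permits cancellation, and [t_sum], which reduces a difference of squares to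
    [n a b e - n b a e]. *)
Lemma structure_const_comm4 (F : fieldType) (K : finType) (n : K -> K -> K -> F)
    (inv : K -> K) (e a b c : K)
    (enumK : perm_eq (enum K) [:: e; a; b; c]) (uniqK : uniq [:: e; a; b; c])
    (inva : inv a = b) (invb : inv b = a) (invc : inv c = c)
    (n_idl : forall i k, n e i k = (k == i)%:R)
    (n_idr : forall i k, n i e k = (k == i)%:R)
    (n_sum : forall i j, \sum_(k : K) n i j k = 1)
    (n_star : forall i j k, n (inv j) (inv i) (inv k) = n i j k)
    (n_unit : forall i j, j != inv i -> n i j e = 0)
    (frob : forall i j k,
       n i j k * n k (inv k) e = n j (inv k) (inv i) * n i (inv i) e)
    (t_nz : forall i, n i (inv i) e != 0)
    (t_sum : n a b e + n b a e != 0) :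
  forall i j k, n i j k = n j i k.
Proof.
have inK k : k \in [:: e; a; b; c] by rewrite -(perm_mem enumK) mem_enum.
have sumK i j : n i j e + n i j a + n i j b + n i j c = 1.
  rewrite -(n_sum i j) -big_enum /= (perm_big _ enumK) /=.
  by rewrite !big_cons big_nil addr0 !addrA.
(* Both products have mass one, so agreement at [e], [a] and [b] forces agreement at [c]. *)
have comm3 i j : n i j e = n j i e -> n i j a = n j i a ->
    n i j b = n j i b -> forall k, n i j k = n j i k.
  move=> ee ea eb k; have := inK k; rewrite !inE.
  case/or4P => /eqP -> //; apply: (addrI (n i j e + n i j a + n i j b)).
  by rewrite sumK ee ea eb sumK.
have := t_nz a; have := t_nz b; have := t_nz c; rewrite inva invb invc.
move=> tc_nz tb_nz ta_nz.
(* The products of [a] and [b], in either order, have coefficient [n a a a] at both [a] and [b]: at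
   [b] by reciprocity, at [a] by applying the involution. *)
have Eabb : n a b b = n a a a.
  by have := frob a a a; rewrite inva => /(mulIf ta_nz).
have Ebab : n b a b = n a a a.
  by have := frob b a b; rewrite invb => /(mulIf tb_nz).
have Eaba : n a b a = n a a a by rewrite -Eabb -[RHS]n_star inva invb.
have Ebaa : n b a a = n a a a by rewrite -Ebab -[RHS]n_star inva invb.
have zero_a : n a a a * (n a b e - n b a e) = 0.
  have := frob b a a; rewrite inva invb Ebaa Eaba => E.
  by rewrite mulrBr E subrr.
have zero_b : n a a b * (n a b e - n b a e) = 0.
  have := frob a a b; rewrite inva invb => E.
  by rewrite mulrBr E subrr.
(* Rotating the Frobenius relation three times multiplies by [(t a / t b)^2]. *)
have zero_c : n a a c * (n a b e - n b a e) = 0.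
  have := frob c a b; have := frob a c b; have := frob a a c.
  rewrite inva invb invc => E1 E2 E3.
  apply: (mulIf tc_nz); apply: (mulIf t_sum); rewrite !mul0r.
  transitivity (n a a c * n c c e * n a b e ^+ 2
                - n a a c * n c c e * n b a e ^+ 2); first by ring.
  apply/eqP; rewrite subr_eq0 -{1}E3 E1; apply/eqP.
  transitivity (n a c b * n b a e * n a b e * n b a e); last by ring.
  by rewrite E2; ring.
have tab : n a b e = n b a e.
  have ae0 : n a a e = 0.
    rewrite n_unit // inva; apply: contraTneq uniqK => ->.
    by rewrite /= !inE eqxx !andbF.
  (* The factor [1] is expanded as the total mass of the square of [a], each remaining term of which
     annihilates the difference. *)
  apply/eqP; rewrite -subr_eq0 -[_ - _]mul1r -(sumK a a) ae0 add0r.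
  by rewrite !mulrDl zero_a zero_b zero_c !addr0.
have ab k : n a b k = n b a k.
  by apply: comm3; rewrite ?Eaba ?Ebaa ?Eabb ?Ebab.
have ac k : n a c k = n c a k.
  apply: comm3.
  - rewrite !n_unit ?inva ?invc //; apply: contraTneq uniqK => ->;
      by rewrite /= !inE eqxx ?orbT !andbF.
  (* Once [tab] identifies the two weights, reciprocity turns the sides into [n b a c * n c c e] and
     [n a b c * n c c e], equal by [ab]. *)
  - apply: (mulIf ta_nz).
    have := frob c a a; have := frob a c a; have := frob c b b.
    rewrite inva invb invc -tab => E1 E2 E3.
    by rewrite E2 E1 E3 ab.
  - have := frob a c b; rewrite inva invb -tab; exact: (mulIf ta_nz).
(* The involution carries the products of [b] and [c] to those of [a] and [c]. *)
have bc k : n b c k = n c b k.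
  by rewrite -n_star -[RHS]n_star invb invc ac.
move=> i j k; have := inK i; have := inK j; rewrite !inE.
by case/or4P => /eqP -> /or4P[] /eqP -> //; rewrite n_idl n_idr.
Qed.

Theorem theorem3p3 (R : realType) (K : finType) (H : hypergroup R K)
  (order_four : order_hypergroup H = 4) : commutative_hypergroup H.
Proof.
have [inv [invK inv_star inv_supp]] := hypergroup_inverse H.
have HA := hypergroup_star_algebra H.
apply: commutative_structure_const.
have n_star := structure_const_star invK inv_star.
have frob := structure_const_frobenius invK inv_supp.
set e := hunit H in frob.
have n_idl i k : structure_const H e i k = (k == i)%:R.
  by rewrite /structure_const (mul_left_id HA) ffunE.
have n_idr i k : structure_const H i e k = (k == i)%:R.
  by rewrite /structure_const (mul_right_id HA) ffunE.
have n_sum i j : \sum_(k : K) structure_const H i j k = 1.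
  by case: (hypergroup_probability H i j).
have n_unit i j : j != inv i -> structure_const H i j e = 0.
  move=> ji; apply/eqP; apply: contraNT ji => nz.
  by apply/eqP/inv_supp; rewrite inE.
have t_nz i : structure_const H i (inv i) e != 0.
  by have /inv_supp := erefl (inv i); rewrite inE.
have t_gt0 i : 0 < structure_const H i (inv i) e.
  by rewrite lt0r t_nz; case: (hypergroup_probability H i (inv i)) => ->.
(* The unit lies in the support of its own square. *)
have inve : inv e = e.
  by apply/esym/inv_supp; rewrite (mul_left_id HA) inE ffunE eqxx oner_neq0.
have [/forallP inv_id|] := boolP [forall i, inv i == i].
  by move=> i j k; rewrite -n_star !(eqP (inv_id _)).
rewrite negb_forall => /existsP[a inva]; set b := inv a in inva.
have ae : a != e by apply: contraNneq inva => ae; rewrite /b ae inve.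
have be : b != e by rewrite -inve (inj_eq (inv_inj invK)).
have [c c_new] : exists c, c \notin [:: e; a; b].
  apply/existsP; apply: contraT; rewrite negb_exists => /forallP all3.
  have /(uniq_leq_size (enum_uniq K)) : {subset enum K <= [:: e; a; b]}.
    by move=> k _; have := all3 k; rewrite negbK.
  by rewrite -cardE -[#|K|]/(order_hypergroup H) order_four.
have uniqK : uniq [:: e; a; b; c].
  move: c_new; rewrite /= !inE !negb_or => /and3P[ce ca cb].
  rewrite !(eq_sym e) (eq_sym a b) (eq_sym a c) (eq_sym b c).
  by rewrite ae be ce inva ca cb.
have enumK : perm_eq (enum K) [:: e; a; b; c].
  rewrite perm_sym uniq_perm ?enum_uniq //.
  have sub : {subset [:: e; a; b; c] <= enum K} by move=> k; rewrite mem_enum.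
  case: (uniq_min_size uniqK sub) => //.
  by rewrite -cardE -[#|K|]/(order_hypergroup H) order_four.
(* The involution permutes [e], [a] and [b] among themselves, so the one remaining element is
   fixed. *)
have invc : inv c = c.
  have : inv c \in [:: e; a; b; c] by rewrite -(perm_mem enumK) mem_enum.
  move: c_new; rewrite !inE !negb_or => /and3P[ce ca cb].
  rewrite !(can2_eq invK invK) inve -/b [inv b]invK.
  by rewrite (negbTE ce) (negbTE ca) (negbTE cb) => /= /eqP {1}->.
apply: (@structure_const_comm4 _ _ _ inv e a b c) => //; first exact: invK.
rewrite gt_eqF // addr_gt0 ?t_gt0 //.
by have := t_gt0 b; rewrite /b invK.
Qed.
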